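(* Let $n=p^\ell m$, where $p$ is a prime and $\ell\geq 1$, $m\geq 2$ are integers, and let $\mathrm{Cay}(\mathbb{Z}_n,S)$ be a connected circulant graph of order $n$ and degree $p^\ell-1$. Assume that $S_0$ is pyramidal, with associated sequences $\mathbf{h}(S_0) = (h_0, h_1, \ldots, h_t)$ and $\mathbf{k}(S_0) = (k_0, k_1, \ldots, k_t)$. Then the number $c(S)$ of distinct perfect codes containing $0$ in $\mathrm{Cay}(\mathbb{Z}_n,S)$ satisfies $$c(S)\ge p^{\left(\sum_{i=0}^{t-1}(h_{i-1}-h_{i})k_{i}\right)+h_{t-1}-\ell},$$ where $h_{-1} = \ell$.
   Context: Groups are additive; $\mathrm{Cay}(\mathbb{Z}_n,S)$ (with $S=-S\subseteq\mathbb{Z}_n\setminus\{0\}$) has $x\sim y$ iff $x-y\in S$; $S_0=S\cup\{0\}$. A perfect code is a vertex set $D$ such that every vertex is at distance at most $1$ from exactly one vertex of $D$. For a subgroup $H$ and $X\subseteq G$, $X/H=\{x+H:x\in X\}$. A nonzero $a$ with $X+a=X$ is a period of $X$; periods with $0$ form the subgroup of periods; $X$ is periodic if this subgroup is nontrivial, aperiodic otherwise, and $K$-periodic if $K$ (nontrivial) is its subgroup of periods. Pyramidal set: $X\subseteq G$ with $0\in X$ is pyramidal if there is a series $H_0<H_1<\cdots<H_{2t-1}\le H_{2t}=G$, $t\ge1$, such that either (a) $H_0=\{0\}$, $X$ aperiodic, and (T1) $(X/H_{2i}-X/H_{2i})\cap(H_{2i+1}/H_{2i})=\{0\}$ for $0\le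 i\le t-1$; (T2) $X/H_{2i-1}$ is $(H_{2i}/H_{2i-1})$-periodic for $1\le i\le t$; (T3) $|X/H_{2t-1}|=|G/H_{2t-1}|$ and $|X/H_{2i}|=|X/H_{2i+1}|$ for $0\le i\le t-1$; or (b) $H_0\ne\{0\}$, $X$ is $H_0$-periodic and $X/H_0$ satisfies (T1)–(T3) in $G/H_0$ with respect to the series $H_i/H_0$. Such a series is an admissible subgroup series of length $2t$ associated with $X$. Associated sequences: for pyramidal $S_0$ with $|S_0|=p^\ell$ in $\mathbb{Z}_n$, let $H_0<H_1<\cdots<H_{2t-1}\le H_{2t}=\mathbb{Z}_n$ be the longest admissible subgroup series associated with $S_0$ (the paper shows it is unique). Set $k_0=m$ and let $h_0$ be such that $H_0=\langle p^{h_0}m\rangle$ (so $h_0=\ell$ if $S_0$ is aperiodic, $h_0<\ell$ if periodic); for $1\le i\le t$ let $k_i=k_{i-1}/|H_{2i-1}/H_{2i-2}|$ and $h_i=h_{i-1}-\log_p|H_{2i}/H_{2i-1}|$, so that $H_{2i-1}=\langle p^{h_{i-1}}k_i\rangle$, $H_{2i}=\langle p^{h_i}k_i\rangle$, $k_t=1$, $h_t=0$. *)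

(* Defs.v *)
From HB Require Import structures.
From mathcomp Require Import all_boot all_order all_algebra all_fingroup.

Set Implicit Arguments.
Unset Strict Implicit.
Unset Printing Implicit Defensive.

Import GRing.Theory.

Section Graph.
Variables (T : finType) (e : rel T).

Definition connected_graph : Prop := forall x y : T, connect e x y.

Definition regular_of_degree (d : nat) : Prop :=
  forall x : T, #|[set y | e x y]| = d.

Definition perfect_code (D : {set T}) : bool :=
  [forall x, #|[set d in D | (x == d) || e x d]| == 1].

End Graph.

Definition cay (n : nat) (S : {set 'Z_n}) : rel 'Z_n :=
  fun x y => (x - y)%R \in S.

Definition connection_set (n : nat) (S : {set 'Z_n}) : Prop :=
  0%R \notin S /\ [set (- x)%R | x in S] = S.

Definition num_codes0 (n : nat) (S : {set 'Z_n}) : nat :=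
  #|[set D : {set 'Z_n} | perfect_code (cay S) D & 0%R \in D]|.

(* The ambient abelian group G is [set: gT], written multiplicatively as the  *)
(* quotient library requires; on 'Z_n the canonical group law is addition.    *)
(* For abelian gT, X / H is exactly the set of all cosets x + H, x in X.      *)
Section Pyramidal.
Local Open Scope group_scope.

Definition periods (gT : finGroupType) (X : {set gT}) : {set gT} :=
  [set a | X :* a == X].

Definition aperiodic (gT : finGroupType) (X : {set gT}) : Prop :=
  periods X = 1.

(* A subgroup series H_0, ..., H_2t is a function on nat of which only the    *)
(* values at 0, ..., 2t are ever used.                                        *)
Definition subgroup_series (gT : finGroupType) (t : nat)
    (H : nat -> {group gT}) : Prop :=
  [/\ 0 < t,
      forall i, i < t.*2.-1 -> H i \proper H i.+1,
      H t.*2.-1 \subset H t.*2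
    & H t.*2 = [set: gT] :> {set gT}].

Definition T1 (gT : finGroupType) (X : {set gT}) (t : nat)
    (H : nat -> {group gT}) : Prop :=
  forall i, i < t ->
    ((X / H i.*2) * (X / H i.*2)^-1) :&: (H i.*2.+1 / H i.*2) = 1.

(* H_(2i) / H_(2i-1) is nontrivial by strictness of the series, except        *)
(* possibly for i = t, where H_(2t-1) = H_(2t) = G is allowed; the condition  *)
(* then holds trivially.                                                      *)
Definition T2 (gT : finGroupType) (X : {set gT}) (t : nat)
    (H : nat -> {group gT}) : Prop :=
  forall i, 0 < i <= t ->
    periods (X / H i.*2.-1) = H i.*2 / H i.*2.-1.

Definition T3 (gT : finGroupType) (X : {set gT}) (t : nat)
    (H : nat -> {group gT}) : Prop :=
  #|X / H t.*2.-1| = #|[set: gT] / H t.*2.-1| /\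
  forall i, i < t -> #|X / H i.*2| = #|X / H i.*2.+1|.

Definition T123 (gT : finGroupType) (X : {set gT}) (t : nat)
    (H : nat -> {group gT}) : Prop :=
  [/\ T1 X t H, T2 X t H & T3 X t H].

Definition admissible (gT : finGroupType) (X : {set gT}) (t : nat)
    (H : nat -> {group gT}) : Prop :=
  subgroup_series t H /\
  ([/\ H 0 = 1 :> {set gT}, aperiodic X & T123 X t H] \/
   [/\ H 0 <> 1 :> {set gT}, periods X = H 0
     & T123 (X / H 0) t (fun i => (H i / H 0)%G)]).

Definition pyramidal (gT : finGroupType) (X : {set gT}) : Prop :=
  1 \in X /\ exists t H, admissible X t H.

Definition longest_admissible (gT : finGroupType) (X : {set gT}) (t : nat)
    (H : nat -> {group gT}) : Prop :=
  admissible X t H /\ forall t' H', admissible X t' H' -> t' <= t.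

(* The bound h 0 <= l makes h_0 unique, since <p^h m> = {0} in Z_n for every  *)
(* h >= l. The indices |H_2i / H_(2i-1)| are powers of p (they divide |X|),   *)
(* so logn p is the logarithm to base p, and the division and the subtraction *)
(* are exact.                                                                 *)
Definition associated_sequences (n p l m : nat) (X : {set 'Z_n}) (t : nat)
    (h k : nat -> nat) : Prop :=
  exists H : nat -> {group 'Z_n},
  [/\ longest_admissible X t H,
      k 0 = m,
      h 0 <= l /\ H 0 = <[ (p ^ h 0 * m)%N%:R%R : 'Z_n ]> :> {set 'Z_n}
    & forall i, 0 < i <= t ->
        k i = k i.-1 %/ #|H i.*2.-1 / H i.*2.-2| /\
        h i = h i.-1 - logn p #|H i.*2 / H i.*2.-1| ].

End Pyramidal.

(* hprev l h i is h_(i-1), with the convention h_(-1) = l. *)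
Definition hprev (l : nat) (h : nat -> nat) (i : nat) : nat :=
  if i is j.+1 then h j else l.

(* Main.v *)
Require Import Defs.
From HB Require Import structures.
From mathcomp Require Import all_boot all_order all_algebra all_fingroup.

(* A perfect code is a tiling complement D of X = S_0. Write X_j for the image *)
(* of X in G / H_j. Tiling complements are built from the top of the series   *)
(* down. Since X_(2t-1) is everything, a single point is a complement there.  *)
(* By (T1), X_(2i) maps bijectively onto X_(2i+1), so the full preimage of a  *)
(* complement of X_(2i+1) is a complement of X_(2i). By (T2), X_(2i-1) is the *)
(* full preimage of X_(2i), so every transversal lift of a complement of      *)
(* X_(2i) is a complement of X_(2i-1); the complement has k_i points, one of  *)
(* which must lift to 0, which leaves |H_2i / H_(2i-1)| ^ (k_i - 1) distinct  *)
(* lifts. The case i = 0, with H_(-1) = 0, lifts from G / H_0 to G. The bound *)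
(* is the product of these numbers over 0 <= i < t.                           *)

Set Implicit Arguments.
Unset Strict Implicit.
Unset Printing Implicit Defensive.

(** The two moves down the series are [codes_sub] (preimages) and [leq_card_codes] (lifts), chained
    in [leq_card_codes_series]; [admissible_layered_tile] extracts their hypotheses from (T1)-(T3),
    and [codes_perfect] returns to the graph. The differences h_(i-1) - h_i for i < t telescope to l
    - h_(t-1), so the stated exponent is the sum of (h_(i-1) - h_i)(k_i - 1), one free lift for each
    point other than 0. *)

Section Codes.
Local Open Scope group_scope.
Variable gT : finGroupType.
Hypothesis mulC : commutative (@mulg gT).
Implicit Types (X D : {set gT}) (H K L : {group gT}) (c : nat).

(** * Tiling complements modulo a subgroup *)

(* The image of D in G / H is a tiling complement of the image of X, counted  *)
(* in G itself for H-invariant D.                                             *)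
Definition tiles X H D :=
  [forall g, #|[set d in D | g * d^-1 \in X * H]| == #|H|].

Definition codes X H c :=
  [set D : {set gT} | [&& 1 \in D, D * H == D, #|D| == (c * #|H|)%N & tiles X H D]].

Lemma codesP X H c D :
  reflect [/\ 1 \in D, D * H = D, #|D| = (c * #|H|)%N &
    forall g, #|[set d in D | g * d^-1 \in X * H]| = #|H| ]
   (D \in codes X H c).
Proof.
rewrite inE; apply: (iffP and4P) => [] [D1 DH Dc Dt]; split => //.
- exact/eqP.
- exact/eqP.
- by move=> g; apply/eqP/(forallP Dt).
- exact/eqP.
- exact/eqP.
- by apply/forallP => g; apply/eqP.
Qed.

Lemma mulg_right_comm (x y z : gT) : x * y * z = x * z * y.
Proof. by rewrite -!mulgA (mulC y). Qed.

Lemma mem_mulGr X H x h : h \in H -> (x * h \in X * H) = (x \in X * H).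
Proof.
move=> hH; apply/idP/idP => /mulsgP [y k yX kH].
  move=> e; apply/mulsgP; exists y (k * h^-1) => //; first by rewrite groupMr ?groupV.
  by rewrite mulgA -e mulgK.
by move->; rewrite -mulgA mem_mulg // groupM.
Qed.

Lemma rcoset_sub_invariant D H d : D * H = D -> d \in D -> H :* d \subset D.
Proof.
move=> DH dD; apply/subsetP => x /rcosetP [h hH ->].
by rewrite mulC -DH mem_mulg.
Qed.

Lemma mem_invariant D H d h : D * H = D -> h \in H -> (d * h \in D) = (d \in D).
Proof. by move=> DH hH; rewrite -DH mem_mulGr. Qed.

(** The solution set is nonempty, stable under [H] and has [#|H|] elements, so it is a single
    coset. *)
Lemma tile_rcoset X H D g : D * H = D ->
  #|[set d in D | g * d^-1 \in X * H]| = #|H| ->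
  exists2 d, d \in D & [set d in D | g * d^-1 \in X * H] = H :* d.
Proof.
move=> DH cE; set E := [set d in D | _] in cE *.
have /card_gt0P [d dE] : 0 < #|E| by rewrite cE cardG_gt0.
have dD : d \in D by move: dE; rewrite inE => /andP [].
exists d => //; apply/esym/eqP; rewrite eqEcard card_rcoset cE leqnn andbT.
apply/subsetP => x /rcosetP [h hH ->].
move: dE; rewrite !inE (mulC h) (mem_invariant _ DH) // => /andP [-> gd].
by rewrite invMg (mulC h^-1) mulgA mem_mulGr ?groupV.
Qed.

(** Double counting of the pairs (g, d) with g in the translate of [X * H] by d. *)
Lemma card_tile X H D :
  (forall g, #|[set d in D | g * d^-1 \in X * H]| = #|H|) ->
  (#|D| * #|(X * H)%g| = #|gT| * #|H|)%N.
Proof.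
move=> Dt; rewrite -[RHS]sum_nat_const.
under [RHS]eq_bigr => g _ do rewrite -(Dt g) -sum1dep_card big_mkcondr /=.
rewrite exchange_big /= -sum_nat_const; apply: eq_bigr => d _.
rewrite -big_mkcond sum1dep_card -(card_rcoset (X * H) d).
by apply: eq_card => g; rewrite mem_rcoset inE.
Qed.

Lemma card_rcosets_invariant D H c :
  D * H = D -> #|D| = (c * #|H|)%N -> #|rcosets H D| = c.
Proof.
move=> DH Dc; apply/eqP; rewrite -(eqn_pmul2r (cardG_gt0 H)) -Dc; apply/eqP.
rewrite -[RHS]sum1_card (partition_big_imset (rcoset H)) /=.
rewrite -sum_nat_const; apply: eq_bigr => _ /imsetP [d dD ->].
rewrite !rcosetE sum1dep_card -(card_rcoset H d); apply: eq_card => x.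
rewrite inE rcosetE; apply/idP/andP => [xd|[_ /eqP <-]]; last exact: rcoset_refl.
split; first exact: subsetP (rcoset_sub_invariant DH dD) _ xd.
by apply/eqP/rcoset_eqP.
Qed.

Lemma codes_sub X K L c : L \subset K ->
  (forall x y, x \in X -> y \in X -> x * y^-1 \in K -> x * y^-1 \in L) ->
  codes X K c \subset codes X L (c * #|K : L|).
Proof.
move=> LK XKL; apply/subsetP => D /codesP [D1 DK Dc Dt]; apply/codesP; split=> //.
- apply/eqP; rewrite eqEsubset -{2}DK mulgS //=.
  by apply/subsetP=> d dD; rewrite -[d]mulg1 mem_mulg.
- by rewrite Dc -(Lagrange LK) mulnAC mulnA.
move=> g; have [d dD Ed] := tile_rcoset DK (Dt g).
have : d \in [set d in D | g * d^-1 \in X * K] by rewrite Ed rcoset_refl.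
rewrite inE => /andP [_ /mulsgP [x k xX kK gd]].
have eg : g = x * k * d by rewrite -gd mulgKV.
(* With g = x k d, the solutions modulo [L] are exactly the coset of k d. *)
rewrite -(card_rcoset L (k * d)); apply: eq_card => d'; rewrite inE.
apply/andP/rcosetP => [[d'D]|[u uL ->]]; last first.
  split.
    by rewrite mulgA mulC -DK mem_mulg // groupM // (subsetP LK).
  rewrite eg !invMg !mulgA mulgK mulgK; apply: mem_mulg => //; by rewrite groupV.
move/mulsgP => [y u yX uL e].
have : d' \in [set d in D | g * d^-1 \in X * K].
  by rewrite inE d'D e mem_mulg // (subsetP LK).
rewrite Ed => /rcosetP [k' k'K ed']; rewrite ed' in e *.
(* Both factorizations of g differ by an element of [K]; the hypothesis on [X] forces it into
   [L]. *)
have e2 : x * y^-1 = u * k' * k^-1.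
  have xk : x * k = y * (u * k').
    by apply: (mulIg d); rewrite -eg !mulgA -e -mulgA mulgKV.
  by apply: (mulIg k); rewrite mulgKV mulg_right_comm xk (mulC y) mulgK.
have: x * y^-1 \in L.
  by apply: XKL => //; rewrite e2 !groupM ?groupV // (subsetP LK).
rewrite e2 -mulgA groupMl // => kk.
by exists (k' * k^-1) => //; rewrite mulgA mulgKV.
Qed.

Lemma group_codes X K : X * K = setT -> (K : {set gT}) \in codes X K 1.
Proof.
move=> XK; apply/codesP; split; rewrite ?mulGid ?mul1n //.
by move=> g; apply: eq_card => d; rewrite inE XK in_setT andbT.
Qed.

(** * Lifting a complement to a smaller subgroup *)

(* f selects one K-coset in each L-coset C of D, as a coset f C of K in L     *)
(* translated by the representative of C.                                     *)
Definition refine L D (f : {ffun {set gT} -> {set gT}}) :=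
  [set d in D | (repr (L :* d))^-1 * d \in f (L :* d)].

Section Refine.
Variables (X D : {set gT}) (K L : {group gT}) (c : nat).
Variable f : {ffun {set gT} -> {set gT}}.
Hypothesis KL : K \subset L.
Hypothesis D_code : D \in codes X L c.
Hypothesis f_on : f \in
  pffun_on (K : {set gT}) (rcosets L D :\ (L : {set gT})) (rcosets K L).

Lemma refine_value d : exists2 u, u \in L & f (L :* d) = K :* u.
Proof.
case/pffun_onP: f_on => /subsetP fs fR.
have [fc|/negP nfc] := boolP (L :* d \in rcosets L D :\ (L : {set gT})).
  by have /rcosetsP [u uL ->] : f (L :* d) \in rcosets K L;
    [apply/fR/map_f; rewrite mem_enum | exists u].
exists 1 => //; rewrite rcoset1; apply/eqP/negPn/negP => ne.
by apply: nfc; apply: fs.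
Qed.

Lemma repr_rcoset_div d : (repr (L :* d))^-1 * d \in L.
Proof.
have: repr (L :* d) \in L :* d := mem_repr_rcoset _ _.
by rewrite rcoset_sym mem_rcoset mulC.
Qed.

Lemma refine_rcoset d u : d \in D -> u \in L ->
  (repr (L :* d) * u \in refine L D f) = (u \in f (L :* d)).
Proof.
case/codesP: D_code => D1 DL Dc Dt dD uL.
have e : L :* (repr (L :* d) * u) = L :* d.
  apply/rcoset_eqP; rewrite mulC mem_rcoset -mulgA groupMl // -mem_rcoset.
  exact: mem_repr_rcoset.
rewrite inE e mulKg (mem_invariant _ DL) //.
by rewrite (subsetP (rcoset_sub_invariant DL dD)) // mem_repr_rcoset.
Qed.

Lemma refine_mul : refine L D f * L = D.
Proof.
case/codesP: D_code => D1 DL Dc Dt.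
apply/eqP; rewrite eqEsubset; apply/andP; split; apply/subsetP => d.
  case/mulsgP => d' u; rewrite inE => /andP [d'D _] uL ->.
  by rewrite -DL mem_mulg.
move=> dD; have [u uL fu] := refine_value d.
apply/mulsgP; exists (repr (L :* d) * u) (u^-1 * ((repr (L :* d))^-1 * d)).
- by rewrite refine_rcoset // fu rcoset_refl.
- by rewrite groupM ?groupV // repr_rcoset_div.
- by rewrite mulgA mulgK mulKVg.
Qed.

(** Since X L = X K, the solutions for g in [D] form one [L]-coset, of which the refinement keeps
    exactly one [K]-coset. *)
Lemma refine_codes : X * L \subset X * K -> refine L D f \in codes X K c.
Proof.
move=> XLK; case/codesP: (D_code) => D1 DL Dc Dt.
have {}XLK : X * L = X * K by apply/eqP; rewrite eqEsubset XLK mulgS.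
have RT g : #|[set d in refine L D f | g * d^-1 \in X * K]| = #|K|.
  have [d dD Ed] := tile_rcoset DL (Dt g).
  have [u uL fu] := refine_value d.
  rewrite -(card_rcoset K (u * repr (L :* d))); apply: eq_card => x.
  have -> : (x \in [set d in refine L D f | g * d^-1 \in X * K])
      = (x \in refine L D f) && (x \in L :* d).
    by rewrite -Ed !inE XLK; case: (x \in D); rewrite ?andbF.
  apply/andP/idP => [[xR /rcoset_eqP xd]|/rcosetP [k kK ->]].
    by move: xR; rewrite inE xd fu !mem_rcoset invMg mulgA (mulC x) => /andP [].
  have kuL : k * u \in L by rewrite groupM // (subsetP KL).
  rewrite mulgA -(mulC (repr _)) refine_rcoset // fu mem_rcoset mulgK kK; split=> //.
  by rewrite mulC mem_rcoset -mulgA groupMl // -mem_rcoset mem_repr_rcoset.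
apply/codesP; split => //.
(* The coset [L] is outside the support of [f], so it takes the default value [K]; its
   representative is 1, hence 1 survives. *)
- rewrite -(mulg1 1) -{1}(repr_group L) -{1}(rcoset1 L) refine_rcoset //.
  case/pffun_onP: f_on => /subsetP fs _; rewrite rcoset1.
  have [->//|ne] := eqVneq (f L) K.
  by have := fs L ne; rewrite !inE eqxx.
- apply/eqP; rewrite eqEsubset; apply/andP; split; apply/subsetP => d; last first.
    by move=> dR; rewrite -[d]mulg1 mem_mulg.
  case/mulsgP => d' k; rewrite !inE => /andP [d'D Rd] kK ->.
  have kL : k \in L by rewrite (subsetP KL).
  rewrite (mem_invariant _ DL) // d'D /=.
  have -> : L :* (d' * k) = L :* d' by apply/rcoset_eqP; rewrite mulC mem_rcoset mulgK.
  have [u uL fu] := refine_value d'; move: Rd; rewrite fu !mem_rcoset => Rd.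
  by rewrite [_^-1 * _]mulgA mulg_right_comm groupMr.
(* The size comes from comparing the double counts for [D] and its refinement, after cancelling
   [#|X * K|]. *)
- apply/eqP; rewrite -(eqn_pmul2r (cardG_gt0 L)); apply/eqP.
  have XK0 : 0 < #|X * K|.
    have [d _ Ed] := tile_rcoset DL (Dt 1).
    have : d \in L :* d by apply: rcoset_refl.
    by rewrite -Ed inE XLK => /andP [_ dX]; apply/card_gt0P; exists (1 * d^-1).
  apply/eqP; rewrite -(eqn_pmul2r XK0); apply/eqP.
  rewrite mulnAC (card_tile RT) -(mulnA c) mulnAC -[in RHS]XLK.
  by rewrite (mulnC #|K|) (mulnA c) -Dc (mulnAC #|D|) (card_tile Dt) mulnAC.
Qed.

End Refine.

Lemma refine_inj X D K L c : K \subset L -> D \in codes X L c ->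
  {in pffun_on (K : {set gT}) (rcosets L D :\ (L : {set gT})) (rcosets K L) &,
    injective (refine L D)}.
Proof.
move=> KL Dc f f' fon f'on eqR; apply/ffunP => C.
have [|/negP nC] := boolP (C \in rcosets L D :\ (L : {set gT})).
  case/setD1P => _ /rcosetsP [d dD ->]; apply/setP => u.
  have [uL|/negP nuL] := boolP (u \in L).
    by rewrite -(refine_rcoset f Dc) // eqR (refine_rcoset f' Dc).
  have [v vL ->] := refine_value fon d; have [v' v'L ->] := refine_value f'on d.
  rewrite !mem_rcoset; apply/idP/idP => /(subsetP KL).
    by rewrite groupMr ?groupV.
  by rewrite groupMr ?groupV.
case/pffun_onP: fon => /subsetP fs _; case/pffun_onP: f'on => /subsetP fs' _.
have /eqP -> : f C == K by apply/negPn/negP => ne; apply/nC/fs.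
by apply/esym/eqP/negPn/negP => ne; apply/nC/fs'.
Qed.

(** Sort the codes modulo [K] by the product [D' * L]: the fibre over [D] contains all refinements
    of [D], which are distinct. *)
Lemma leq_card_codes X K L c : K \subset L -> X * L \subset X * K ->
  (#|L : K|%g ^ c.-1 * #|codes X L c| <= #|codes X K c|)%N.
Proof.
move=> KL XLK.
pose fibre D := [set D' in codes X K c | D' * L == D].
have -> : (#|L : K|%g ^ c.-1 * #|codes X L c|)%N =
  \sum_(D in codes X L c) #|L : K| ^ c.-1 by rewrite sum_nat_const mulnC.
apply: (@leq_trans (\sum_(D in codes X L c) #|fibre D|)); last first.
  rewrite -[leqRHS]sum1_card [leqRHS](bigID (fun D' => D' * L \in codes X L c)) /=.
  apply: leq_trans (leq_addr _ _).
  rewrite [leqRHS](partition_big (fun D' => D' * L) (mem (codes X L c)))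
    => [|D /andP []//].
  apply: leq_sum => D Dc; rewrite -sum1_card /= leq_eqVlt; apply/orP; left.
  apply/eqP/eq_bigl => D'; rewrite /fibre inE.
  by case: eqP => [->|_]; rewrite ?andbF // Dc !andbT.
apply: leq_sum => D Dc; case/codesP: (Dc) => D1 DL cD Dt.
have LD : (L : {set gT}) \in rcosets L D.
  by apply/rcosetsP; exists 1; rewrite ?rcoset1.
(* Every [L]-coset of [D] is free except [L] itself, which must lift to 1. *)
have -> : c.-1 = #|rcosets L D :\ (L : {set gT})|.
  by rewrite -(card_rcosets_invariant DL cD) (cardsD1 (L : {set gT})) LD.
rewrite /indexg -(card_pffun_on (K : {set gT})) -(card_in_imset (refine_inj KL Dc)).
apply/subset_leq_card/subsetP => _ /imsetP [f fon ->].
by rewrite inE (refine_codes KL Dc fon XLK) (refine_mul Dc fon) eqxx.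
Qed.

(** * Descent along the whole series *)

Lemma leq_card_codes_series X (K L : nat -> {group gT}) (t : nat) :
    (forall j, j < t -> K j \subset L j) ->
    (forall j, j < t -> L j \subset K j.+1) ->
    (forall j, j < t -> X * L j \subset X * K j) ->
    (forall j, j < t -> forall x y, x \in X -> y \in X ->
       x * y^-1 \in K j.+1 -> x * y^-1 \in L j) ->
    X * K t = setT ->
  (\prod_(0 <= j < t) #|L j : K j|%g ^ (\prod_(j <= i < t) #|K i.+1 : L i|%g).-1
    <= #|codes X (K 0) (\prod_(0 <= i < t) #|K i.+1 : L i|%g)|)%N.
Proof.
move=> KL LK XLK XKL XK.
(* [c j] is the number of points of a complement modulo [K j], and equally modulo [L j]. The
   induction runs on t - j. *)
pose c j := (\prod_(j <= i < t) #|K i.+1 : L i|%g)%N.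
suff: forall s j, (j + s = t)%N ->
  (\prod_(j <= i < t) #|L i : K i|%g ^ (c i).-1 <= #|codes X (K j) (c j)|)%N.
  by move/(_ t 0%N (add0n t)).
elim=> [|s IHs] j jt.
  rewrite addn0 in jt; rewrite jt /c !big_geq //; apply/card_gt0P.
  by exists (K t : {set gT}); apply: group_codes.
have ltjt : j < t by rewrite -jt addnS ltnS leq_addr.
rewrite big_ltn //; apply: leq_trans (leq_card_codes _ (KL _ ltjt) (XLK _ ltjt)).
rewrite leq_mul2l; apply/orP; right.
apply: leq_trans (IHs j.+1 _) _; first by rewrite addSnnS.
have -> : c j = (c j.+1 * #|K j.+1 : L j|)%N by rewrite /c big_ltn // mulnC.
exact: subset_leq_card (codes_sub _ (LK _ ltjt) (XKL _ ltjt)).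
Qed.

End Codes.

(** * Pyramidal conditions without quotients *)

Section Admissible.
Local Open Scope group_scope.
Implicit Type gT : finGroupType.

Lemma subset_norm_comm gT (A : {set gT}) (H : {group gT}) :
  commutative (@mulg gT) -> A \subset 'N(H).
Proof.
move=> mulC; apply/subsetP => x _; rewrite inE; apply/subsetP => y.
by case/imsetP => h hH ->; rewrite conjgE (mulC h) mulKg.
Qed.

Lemma commutative_quotient gT (H : {group gT}) :
  commutative (@mulg gT) -> commutative (@mulg (coset_of H)).
Proof.
move=> mulC x y; case: (cosetP x) => x' x'N ->; case: (cosetP y) => y' y'N ->.
by rewrite -!morphM //= mulC.
Qed.

Lemma mem_quotient_comm gT (A : {set gT}) (H : {group gT}) x :
  commutative (@mulg gT) -> (coset H x \in A / H) = (x \in A * H).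
Proof.
move=> mulC; have N := subset_norm_comm _ H mulC.
have xN : x \in 'N(H) by rewrite -sub1set.
have -> : (x \in A * H) = ([set x] \subset H * A).
  by rewrite sub1set (normC (N _)).
rewrite -quotientSK // /quotient morphim_set1 // sub1set //.
Qed.

(* What (T1)-(T3) say about X inside G, without quotients; the second clause  *)
(* keeps only one inclusion of (T2).                                          *)
Definition layered_tile gT (X : {set gT}) t (H : nat -> {group gT}) : Prop :=
  [/\ forall i, i < t -> forall x y, x \in X -> y \in X ->
        x * y^-1 \in H i.*2.+1 -> x * y^-1 \in H i.*2,
      forall i, 0 < i <= t -> X * H i.*2 \subset X * H i.*2.-1
    & X * H t.*2.-1 = setT].

Lemma T123_layered_tile gT (X : {set gT}) t (H : nat -> {group gT}) :
  commutative (@mulg gT) -> T123 X t H -> layered_tile X t H.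
Proof.
move=> mulC [HT1 HT2 [HT3 _]].
have N (A : {set gT}) (K : {group gT}) : A \subset 'N(K).
  exact: subset_norm_comm mulC.
have Nx x (K : {group gT}) : x \in 'N(K) by rewrite -sub1set.
have MQ (A : {set gT}) (K : {group gT}) x : x \in A -> coset K x \in A / K.
  by move=> xA; apply: mem_morphim => //; apply: Nx.
split.
- move=> i it x y xX yX xyH; apply: coset_idr => //; apply/set1gP.
  rewrite -(HT1 i it) in_setI mem_quotient // andbT.
  rewrite (morphM _ (Nx _ _) (Nx _ _)) (morphV _ (Nx _ _)).
  by rewrite mem_mulg ?memV_invg ?MQ.
- move=> i it; apply/subsetP => _ /mulsgP [x h xX hH ->].
  have : coset (H i.*2.-1) h \in periods (X / H i.*2.-1).
    by rewrite HT2 // MQ.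
  rewrite inE => /eqP XP.
  rewrite -mem_quotient_comm // (morphM _ (Nx _ _) (Nx _ _)) -XP.
  by rewrite mem_rcoset mulgK MQ.
- apply/setP => x; rewrite in_setT -mem_quotient_comm //.
  have /eqP -> : X / H t.*2.-1 == setT / H t.*2.-1.
    by rewrite eqEcard quotientS ?subsetT //= HT3.
  by rewrite MQ.
Qed.

Lemma mulg_periods_sub gT (X : {set gT}) (H : {group gT}) :
  periods X = H -> X * H \subset X.
Proof.
move=> XH; apply/subsetP => _ /mulsgP [x h xX hH ->].
have /eqP <- : X :* h == X by move: hH; rewrite -XH inE.
by rewrite mem_rcoset mulgK.
Qed.

Lemma series_sub gT t (H : nat -> {group gT}) :
  subgroup_series t H -> forall i, i < t.*2 -> H i \subset H i.+1.
Proof.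
case=> t0 Hp He _ i; rewrite leq_eqVlt => /orP [/eqP it|it].
  by move: He; rewrite -it.
by apply: proper_sub; apply: Hp; rewrite -ltnS prednK // double_gt0.
Qed.

Lemma series_sub0 gT t (H : nat -> {group gT}) :
  subgroup_series t H -> forall i, i <= t.*2 -> H 0 \subset H i.
Proof.
move=> HS; elim=> [|i IHi] it //.
exact: subset_trans (IHi (ltnW it)) (series_sub HS it).
Qed.

(** In the periodic case the conditions hold in G / H_0 and pull back, because every H_i contains
    H_0. *)
Lemma admissible_layered_tile gT (X : {set gT}) t (H : nat -> {group gT}) :
  commutative (@mulg gT) -> admissible X t H ->
  X * H 0 \subset X /\ layered_tile X t H.
Proof.
move=> mulC [HS [[H0 _ HT]|[_ XP HT]]].
  by rewrite H0 mulg1 subxx; split=> //; apply: T123_layered_tile.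
split; first exact: mulg_periods_sub.
have [G1 G2 G3] := T123_layered_tile (@commutative_quotient _ _ mulC) HT.
have H0S := series_sub0 HS.
have [t0 _ _ _] := HS.
have N (A : {set gT}) (K : {group gT}) : A \subset 'N(K).
  exact: subset_norm_comm mulC.
have Nx x (K : {group gT}) : x \in 'N(K) by rewrite -sub1set.
have MQ (A : {set gT}) (K : {group gT}) x : x \in A -> coset K x \in A / K.
  by move=> xA; apply: mem_morphim => //; apply: Nx.
have pull i x : i <= t.*2 -> coset (H 0) x \in X / H 0 * (H i / H 0) -> x \in X * H i.
  by move=> it; rewrite -quotientMl // mem_quotient_comm // -mulgA mulGSid ?H0S.
split.
- move=> i it x y xX yX xyH.
  have le2 : i.*2 <= t.*2 by rewrite leq_double ltnW.
  have := G1 i it (coset (H 0) x) (coset (H 0) y).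
  rewrite !MQ // -(morphV _ (Nx _ _)) -(morphM _ (Nx _ _) (Nx _ _)) MQ //.
  move=> /(_ isT isT isT).
  by rewrite mem_quotient_comm // mulGSid ?H0S.
- move=> i it; apply/subsetP => x xXH.
  have le2 : i.*2 <= t.*2 by rewrite leq_double; case/andP: it.
  apply: pull; first exact: leq_trans (leq_pred _) le2.
  by apply: (subsetP (G2 i it)); rewrite /= -quotientMl // MQ.
- apply/setP => x; rewrite in_setT; apply: pull; first exact: leq_pred.
  by move/setP/(_ (coset (H 0) x)): G3; rewrite in_setT.
Qed.

End Admissible.

(* The term H_(2j-1), with the convention H_(-1) = 1. *)
Definition odd_term (gT : finGroupType) (H : nat -> {group gT})
    (j : nat) : {group gT} :=
  if j is i.+1 then H i.*2.+1 else 1%G.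

Lemma leq_card_codes_admissible (gT : finGroupType) (X : {set gT}) t
    (H : nat -> {group gT}) :
  commutative (@mulg gT) -> admissible X t H ->
  \prod_(0 <= j < t)
     #|H j.*2 : odd_term H j|%g ^ (\prod_(j <= i < t) #|H i.*2.+1 : H i.*2|%g).-1
    <= #|codes X 1%G (\prod_(0 <= i < t) #|H i.*2.+1 : H i.*2|%g)|.
Proof.
move=> mulC HA; have [X0 [G1 G2 G3]] := admissible_layered_tile mulC HA.
have [HS _] := HA; have [t0 _ _ _] := HS; have Hsub := series_sub HS.
apply: (@leq_card_codes_series gT mulC X (odd_term H) (fun j => H j.*2)) => //.
- case=> [|j] jt /=; first exact: sub1G.
  by rewrite doubleS Hsub // -doubleS ltn_Sdouble // ltnW.
- by move=> j jt; rewrite /= Hsub // ltn_double.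
(* The bottom lift, from G / H_0 to G, uses that [X] is H_0-invariant. *)
- case=> [|j] jt; first by rewrite /= mulg1.
  by apply: (G2 j.+1); exact: ltnW.
- by case: t t0 G3 {HA G1 G2 HS Hsub}.
Qed.

(** * Return to circulant graphs and to the numerical bound *)

Lemma codes_card_mul (gT : finGroupType) (X : {set gT}) c :
  0 < #|codes X 1%G c| -> c * #|X| = #|gT|.
Proof.
case/card_gt0P => D /codesP [_ _ Dc /card_tile].
by rewrite Dc mulg1 cards1 !muln1.
Qed.

Lemma codes_perfect n (S : {set 'Z_n}) c :
  codes (0%R |: S) 1%G c \subset
    [set D : {set 'Z_n} | perfect_code (cay S) D & 0%R \in D].
Proof.
apply/subsetP => D /codesP [D0 _ _ Dt]; rewrite inE D0 andbT.
apply/forallP => x; apply/eqP; move: (Dt x); rewrite mulg1 cards1 => <-.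
apply: eq_card => d; rewrite !inE /cay; congr (_ && (_ || _)).
by rewrite -GRing.subr_eq0.
Qed.

(** If o kills p^h m, then p^l m divides o p^h m, so p^(l-h) divides o. *)
Lemma leq_order_natr n p h l m :
  n = p ^ l * m -> 1 < n -> 0 < m -> prime p -> h <= l ->
  p ^ (l - h) <= #[(p ^ h * m)%:R%R : 'Z_n]%g.
Proof.
move=> en n1 m0 pp hl; set x : 'Z_n := ((p ^ h * m)%:R)%R.
apply: dvdn_leq; first exact: order_gt0.
have : (x *+ #[x]%g = 0)%R.
  have : (x ^+ #[x] = 1)%g by apply: expg_order.
  by rewrite FinRing.zmodXgE.
set o := #[x]%g; rewrite /x -GRing.mulrnA => /(congr1 (@nat_of_ord _)).
rewrite (val_Zp_nat n1) => /eqP; rewrite -[_ == _]/(n %| _) en.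
rewrite -{1}(subnKC hl) expnD -!mulnA dvdn_pmul2l ?expn_gt0 ?prime_gt0 //.
by rewrite mulnC dvdn_pmul2l.
Qed.

Theorem theorem1p4 (n p l m : nat) (S : {set 'Z_n})
    (t : nat) (h k : nat -> nat) :
  n = p ^ l * m -> prime p -> 1 <= l -> 2 <= m ->
  connection_set S ->
  connected_graph (cay S) ->
  regular_of_degree (cay S) (p ^ l - 1) ->
  pyramidal (0%R |: S) ->
  associated_sequences p l m (0%R |: S) t h k ->
  p ^ ((\sum_(0 <= i < t) (hprev l h i - h i) * k i) + h t.-1 - l)
    <= num_codes0 S.
Proof.
move=> en pp l1 m2 [S0 SV] _ deg _ [H [[HA _] k0 [h0l H0] hk]].
have p1 := prime_gt1 pp; have p0 := prime_gt0 pp.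
have pl0 : 0 < p ^ l by rewrite expn_gt0 p0.
have n1 : 1 < n by rewrite en (leq_trans m2) // leq_pmull.
have mulC : commutative (@mulg 'Z_n) by move=> x y; apply: GRing.addrC.
have cX : #|(0%R |: S)| = p ^ l.
  rewrite cardsU1 S0 /= -(subnKC pl0); congr (_ + _).
  (* The neighbours of 0 are the y with -y in [S], which is [S] by symmetry. *)
  rewrite -(deg 0%R); apply: eq_card => y; rewrite inE /cay GRing.sub0r -{1}SV.
  apply/imsetP/idP => [[x xS ->]|yS]; first by rewrite GRing.opprK.
  by exists (- y)%R; rewrite ?GRing.opprK.
set X := (0%R |: S) in HA cX.
have [HS _] := HA; have [t0 _ _ _] := HS; have Hsub := series_sub HS.
have := leq_card_codes_admissible mulC HA.
pose c j := \prod_(j <= i < t) #|H i.*2.+1 : H i.*2|%g.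
rewrite -/(c 0) -[X in X <= _]/
  (\prod_(0 <= j < t) #|H j.*2 : odd_term H j|%g ^ (c j).-1).
have c_gt0 j : 0 < c j by apply: prodn_gt0 => i; apply: indexg_gt0.
move=> le_codes.
(* The lower bound is positive, so a complement exists, and its size times p^l is n. *)
have cm : c 0 = m.
  apply/eqP; rewrite -(eqn_pmul2r pl0) -cX (@codes_card_mul _ X (c 0)).
    by rewrite card_ord Zp_cast // cX en mulnC.
  apply: leq_trans le_codes; apply: prodn_gt0 => j.
  by rewrite expn_gt0 indexg_gt0.
have kc j : j <= t -> k j = c j.
  elim: j => [|j IHj] jt; first by rewrite k0 cm.
  have [-> _] := hk j.+1 jt; rewrite IHj ?(ltnW jt) //.
  rewrite card_quotient; last exact: subset_norm_comm mulC.
  by rewrite /c big_ltn // mulKn // indexg_gt0.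
have hprev_ge j : j < t -> h j <= hprev l h j.
  case: j => [|j] jt //; have [_ ->] := hk j.+1 (ltnW jt); exact: leq_subr.
have hidx j : j < t -> p ^ (hprev l h j - h j) <= #|H j.*2 : odd_term H j|%g.
  case: j => [|j] jt /=; first by rewrite indexg1 H0 leq_order_natr // ltnW.
  have [_ ->] := hk j.+1 (ltnW jt).
  rewrite /= card_quotient; last exact: subset_norm_comm mulC.
  apply: leq_trans (_ : p ^ logn p #|H j.+1.*2 : H j.*2.+1|%g <= _).
    by rewrite leq_exp2l // leq_subCl.
  by apply: dvdn_leq; rewrite ?indexg_gt0 // pfactor_dvdnn.
apply: leq_trans (subset_leq_card (codes_perfect S (c 0))).
apply: leq_trans le_codes.
have tele s : s < t -> \sum_(0 <= i < s.+1) (hprev l h i - h i) + h s = l.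
  elim: s => [|s IHs] st; first by rewrite big_nat1 subnK // hprev_ge.
  rewrite big_nat_recr //= -addnA subnK; last exact: (hprev_ge s.+1).
  by rewrite IHs // ltnW.
(* Replacing l by the telescoped sum plus h_(t-1) turns each factor k_i into k_i - 1. *)
have -> : \sum_(0 <= i < t) (hprev l h i - h i) * k i + h t.-1 - l =
    \sum_(0 <= i < t) (hprev l h i - h i) * (c i).-1.
  rewrite -[X in _ - X](tele t.-1) ?prednK // subnDr.
  have -> : \sum_(0 <= i < t) (hprev l h i - h i) * k i =
     \sum_(0 <= i < t) (hprev l h i - h i) * (c i).-1
     + \sum_(0 <= i < t) (hprev l h i - h i).
    rewrite -big_split; apply: eq_big_nat => i /andP [_ it] /=.
    by rewrite kc ?(ltnW it) // -mulnSr prednK.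
  by rewrite addnK.
rewrite expn_sum big_nat [leqRHS]big_nat; apply: leq_prod => j /andP [_ jt].
rewrite expnM; case: (c j).-1 => [|e]; first by rewrite !expn0.
by rewrite leq_exp2r // hidx.
Qed.
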